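(* Let $n,m \geq 1$ and $k \geq 0$ be integers, let $U \subseteq [n]\times[m]$, and define $S = ([n]\times[m])\setminus U$ (specified entries of an $n\times m$ matrix) and $S' = ([n+k]\times[m+k])\setminus U$ (specified entries of an $(n+k)\times(m+k)$ matrix). Then the generic completion corank of $S$ equals the generic completion corank of $S'$, and the set of typical coranks of $S$ equals the set of typical coranks of $S'$. Additionally, for every integer $0 \leq r \leq \min\{n,m\}$, $S$ is generically uniquely completable to corank $r$ if and only if $S'$ is generically uniquely completable to corank $r$.
   Context: $[n] = \{1,\ldots,n\}$. Let $S \subseteq [a]\times[b]$ be the specified entries of an $a\times b$ matrix, and let $\pi_S$ be the projection of matrices onto the coordinates indexed by $S$. A completion of $A \in \mathbb{C}^S$ to rank $\rho$ is a matrix $M \in \mathbb{C}^{a\times b}$ of rank at most $\rho$ with $\pi_S(M)=A$. ''Generic'' means for all points outside a proper Zariski closed subset. $S$ is generically completable to rank $\rho$ if a generic $A\in\mathbb{C}^S$ has such a completion. The generic completion rank of $S$ is the lowest $\rho$ to which $S$ is generically completable, and the generic completion corank is $\min\{a,b\}$ minus it. $S$ is generically uniquely completable to rank $\rho$ if a generic $A \in \mathbb{C}^S$ has a unique completion to rank $\rho$, i.e. a generic fiber of the restriction of $\pi_S$ to the variety of $a\times b$ matrices of rank at most $\rho$ is one reduced point; ''to corank $r$'' means to rank $\min\{a,b\}-r$. An integer $\rho$ is a typical rank of $S$ if there is a nonempty Euclidean open subset of $\mathbb{R}^S$ such that for every $A$ in it the minimum rank of a matrix $M\in\mathbb{R}^{a\times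 b}$ with $\pi_S(M)=A$ is $\rho$; the typical coranks of $S$ are $\min\{a,b\}-\rho$ for typical ranks $\rho$. *)

(* Defs.v *)
From mathcomp Require Import all_boot all_order all_algebra.
From mathcomp Require Import boolp classical_sets reals topology.
From mathcomp Require Import normedtype.
From mathcomp.real_closed Require Import complex.
(* Its notations clash with those of mathcomp-analysis. *)
From mathcomp.multinomials Require Import -(notations) mpoly.

Set Implicit Arguments.
Unset Strict Implicit.
Unset Printing Implicit Defensive.

Import Order.TTheory GRing.Theory Num.Theory.
Import numFieldNormedType.Exports.

Local Open Scope classical_set_scope.
Local Open Scope ring_scope.

Notation MPoly F N := (mpoly N F).

(* F^S is 'rV[F]_#|S|; coordinate j is the entry at position enum_val j of S. *)
Definition proj (F : fieldType) (a b : nat) (S : {set 'I_a * 'I_b})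
    (M : 'M[F]_(a, b)) : 'rV[F]_#|S| :=
  \row_(j < #|S|) M (enum_val j).1 (enum_val j).2.

Definition is_completion (F : fieldType) (a b : nat) (S : {set 'I_a * 'I_b})
    (rho : nat) (A : 'rV[F]_#|S|) (M : 'M[F]_(a, b)) : Prop :=
  (\rank M <= rho)%N /\ proj S M = A.

Definition peval (F : fieldType) (N : nat) (p : MPoly F N) (x : 'rV[F]_N) : F :=
  meval (fun i => x 0 i) p.

Definition zariski_closed (F : fieldType) (N : nat) (Z : set 'rV[F]_N) : Prop :=
  exists I : set (MPoly F N), Z = [set x | forall p, I p -> peval p x = 0].

Definition generically (F : fieldType) (N : nat) (P : set 'rV[F]_N) : Prop :=
  exists Z : set 'rV[F]_N,
    [/\ zariski_closed Z, Z != setT & forall x, ~ Z x -> P x].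

Definition generically_completable (F : fieldType) (a b : nat)
    (S : {set 'I_a * 'I_b}) (rho : nat) : Prop :=
  generically (fun A : 'rV[F]_#|S| => exists M, is_completion rho A M).

Lemma generically_completable_minn (F : fieldType) (a b : nat)
    (S : {set 'I_a * 'I_b}) :
  exists rho, `[< generically_completable F S rho >].
Proof.
exists (minn a b); apply/asboolP; exists set0; split.
- exists setT; apply/seteqP; split=> // x /= /(_ 1 Logic.I) /eqP.
  by rewrite /peval meval1 oner_eq0.
- by apply/eqP => /seteqP [_ /(_ 0 Logic.I)].
move=> A _.
exists (\matrix_(i, j)
  if [pick l : 'I_#|S| | enum_val l == (i, j)] is Some l then A 0 l else 0).
split; first by rewrite leq_min rank_leq_row rank_leq_col.
apply/rowP => j; rewrite !mxE; case: pickP => [l /eqP | /(_ j)].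
  by rewrite -surjective_pairing => /enum_val_inj ->.
by rewrite -surjective_pairing eqxx.
Qed.

Definition generic_completion_rank (F : fieldType) (a b : nat)
    (S : {set 'I_a * 'I_b}) : nat :=
  ex_minn (generically_completable_minn F S).

(* The subtraction never truncates: the rank is at most minn a b. *)
Definition generic_completion_corank (F : fieldType) (a b : nat)
    (S : {set 'I_a * 'I_b}) : nat :=
  (minn a b - generic_completion_rank F S)%N.

(* The ideal of all polynomials in the a * b entries (ordered as in mxvec)
   that vanish on the variety of matrices of rank at most rho. *)
Definition rank_ideal (F : fieldType) (a b rho : nat) : set (MPoly F (a * b)) :=
  [set p | forall M : 'M[F]_(a, b),
             (\rank M <= rho)%N -> peval p (mxvec M) = 0].

(* The ideal of the scheme-theoretic fiber over A of proj S restricted to that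
   variety: rank_ideal plus the ideal generated by the x_s - A_s for s in S. *)
Definition fiber_ideal (F : fieldType) (a b : nat) (S : {set 'I_a * 'I_b})
    (rho : nat) (A : 'rV[F]_#|S|) : set (MPoly F (a * b)) :=
  [set p | exists q, exists h : 'I_#|S| -> MPoly F (a * b),
     @rank_ideal F a b rho q /\
     p = q + \sum_(j < #|S|)
           h j * (mpolyX F
                    (mnm1 (mxvec_index (enum_val j).1 (enum_val j).2))
                  - mpolyC (a * b) (A 0 j))].

Definition radical_ideal (F : fieldType) (N : nat) (I : set (MPoly F N)) : Prop :=
  forall p e, I (p ^+ e) -> I p.

(* The fiber is one reduced point; used over an algebraically closed F, where
   the points of the fiber are the completions. *)
Definition unique_completion (F : fieldType) (a b : nat)
    (S : {set 'I_a * 'I_b}) (rho : nat) (A : 'rV[F]_#|S|) : Prop :=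
  (exists! M, is_completion rho A M) /\ radical_ideal (fiber_ideal rho A).

Definition generically_uniquely_completable (F : fieldType) (a b : nat)
    (S : {set 'I_a * 'I_b}) (rho : nat) : Prop :=
  generically (fun A : 'rV[F]_#|S| => unique_completion rho A).

Definition uniquely_completable_to_corank (F : fieldType) (a b : nat)
    (S : {set 'I_a * 'I_b}) (r : nat) : Prop :=
  generically_uniquely_completable F S (minn a b - r).

Definition min_completion_rank_is (F : fieldType) (a b : nat)
    (S : {set 'I_a * 'I_b}) (A : 'rV[F]_#|S|) (rho : nat) : Prop :=
  (exists2 M : 'M[F]_(a, b), proj S M = A & \rank M = rho) /\
  (forall M : 'M[F]_(a, b), proj S M = A -> (rho <= \rank M)%N).

Definition typical_ranks (R : realType) (a b : nat) (S : {set 'I_a * 'I_b}) :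
    set nat :=
  [set rho | exists O : set 'rV[R]_#|S|,
     [/\ open O, O !=set0 & forall A, O A -> min_completion_rank_is A rho]].

(* No truncation here either: a typical rank is the rank of some matrix. *)
Definition typical_coranks (R : realType) (a b : nat) (S : {set 'I_a * 'I_b}) :
    set nat :=
  [set (minn a b - rho)%N | rho in typical_ranks R S].

Definition widen_pair (n m k : nat) (u : 'I_n * 'I_m) : 'I_(n + k) * 'I_(m + k) :=
  (lshift k u.1, lshift k u.2).

(* Main.v *)
(** Write an (n+k) x (m+k) matrix as blocks [M = (A B; C D)] with D of size
    k x k.  If D is invertible, then [rank M = k + rank (A - B D^-1 C)], so the
    completions of M to rank [k + rho] correspond to the completions of the
    Schur complement to rank [rho].  Rescaling the complement by [det D] gives
    [det D A - B adj(D) C], which is polynomial in the entries and hence carries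
    nonempty Zariski or Euclidean open sets of partial matrices back and forth;
    a generic D is invertible.  On coordinate rings, the substitution by the
    (rescaled) Schur complement and its inverse, both taken with the specified
    values of B, C and D, are mutually inverse modulo the two fiber ideals, so
    one fiber is reduced if and only if the other is. *)

From HB Require Import structures.
(* [mpoly] comes before [Defs] because its constructor [MPoly] would shadow the
   notation [MPoly]. *)
From mathcomp.multinomials Require Import -(notations) mpoly.
Require Import Defs.
From mathcomp Require Import all_boot all_order all_algebra.
From mathcomp Require Import boolp classical_sets reals topology normedtype.
From mathcomp.real_closed Require Import complex.

Set Implicit Arguments.
Unset Strict Implicit.
Unset Printing Implicit Defensive.

Import Order.TTheory GRing.Theory Num.Theory.
Import numFieldNormedType.Exports.

Local Open Scope classical_set_scope.
Local Open Scope ring_scope.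

(** * Polynomial rings: induction, evaluation and substitution *)

Lemma mpoly_ring_ind (F : fieldType) (N : nat) (P : MPoly F N -> Prop) :
  (forall c, P (mpolyC N c)) -> (forall i, P (mpolyX F (mnm1 i))) ->
  (forall p q, P p -> P q -> P (p + q)) ->
  (forall p q, P p -> P q -> P (p * q)) -> forall p, P p.
Proof.
move=> PC PX PD PM; elim/mpolyind=> [|c m p _ _ Pp]; first by rewrite -mpolyC0.
apply: (PD) => //; rewrite -mul_mpolyC; apply: (PM) => //.
rewrite mpolyXE_id; apply: (big_ind P) => [|q r|i _]; 
  [by rewrite -mpolyC1 | exact: PM |].
by elim: (m i) => [|e IH]; rewrite ?expr0 -?mpolyC1 // exprS; apply: PM.
Qed.

Section Peval.
Variables (F : fieldType) (N : nat).
Implicit Types (x : 'rV[F]_N) (p q : MPoly F N).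

Definition evalp x p : F := peval p x.

HB.instance Definition _ x :=
  GRing.RMorphism.copy (evalp x) (meval (fun i => x 0 i)).

Lemma evalpC x c : evalp x (mpolyC N c) = c. Proof. exact: mevalC. Qed.

Lemma evalpX x i : evalp x (mpolyX F (mnm1 i)) = x 0 i.
Proof. exact: mevalXU. Qed.

End Peval.

Section Subst.
Variables (F : fieldType) (N1 N2 : nat) (Q : 'rV[MPoly F N2]_N1).

Definition subst : MPoly F N1 -> MPoly F N2 :=
  comp_mpoly [tuple Q 0 i | i < N1].

HB.instance Definition _ :=
  GRing.RMorphism.copy subst (comp_mpoly [tuple Q 0 i | i < N1]).

Lemma substC c : subst (mpolyC N1 c) = mpolyC N2 c.
Proof. exact: comp_mpolyC. Qed.

Lemma substX i : subst (mpolyX F (mnm1 i)) = Q 0 i.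
Proof. by rewrite /subst comp_mpolyXU -tnth_nth tnth_mktuple. Qed.

Lemma evalp_subst x p : evalp x (subst p) = evalp (map_mx (evalp x) Q) p.
Proof.
rewrite /evalp/peval /subst comp_mpoly_meval; apply: meval_eq => i.
by rewrite tnth_mktuple mxE.
Qed.

End Subst.

Lemma rmorph_subst (F : fieldType) (N1 N2 N3 : nat) (Q : 'rV[MPoly F N2]_N1)
    (f : {rmorphism MPoly F N2 -> MPoly F N3}) p :
  (forall c, f (mpolyC N2 c) = mpolyC N3 c) ->
  f (subst Q p) = subst (map_mx f Q) p.
Proof.
move=> fC; elim/mpoly_ring_ind: p => [c|i|p q IHp IHq|p q IHp IHq].
- by rewrite !substC fC.
- by rewrite !substX mxE.
- by rewrite !rmorphD IHp IHq.
by rewrite !rmorphM IHp IHq.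
Qed.

Definition varmx (F : fieldType) (a b : nat) : 'M[MPoly F (a * b)]_(a, b) :=
  \matrix_(i, j) mpolyX F (mnm1 (mxvec_index i j)).

Lemma map_varmx_evalp (F : fieldType) (a b : nat) (M : 'M[F]_(a, b)) :
  map_mx (evalp (mxvec M)) (varmx F a b) = M.
Proof. by apply/matrixP=> i j; rewrite !mxE evalpX mxvecE. Qed.

Lemma map_varmx_subst (F : fieldType) (a b N : nat) (M : 'M[MPoly F N]_(a, b)) :
  map_mx (subst (mxvec M)) (varmx F a b) = M.
Proof. by apply/matrixP=> i j; rewrite !mxE substX mxvecE. Qed.

Lemma subst_varmx (F : fieldType) (a b : nat) (p : MPoly F (a * b)) :
  subst (mxvec (varmx F a b)) p = p.
Proof.
elim/mpoly_ring_ind: p => [c|l|p q IHp IHq|p q IHp IHq].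
- exact: substC.
- by case/mxvec_indexP: l => i j; rewrite substX mxvecE mxE.
- by rewrite rmorphD /= IHp IHq.
by rewrite rmorphM /= IHp IHq.
Qed.

Lemma map_mpolyC (F : fieldType) (N a b : nat) (A : nzRingType)
    (f : {rmorphism MPoly F N -> A}) (g : F -> A) (M : 'M[F]_(a, b)) :
  (forall c, f (mpolyC N c) = g c) ->
  map_mx f (map_mx (@mpolyC N F) M) = map_mx g M.
Proof. by move=> h; apply/matrixP=> i j; rewrite !mxE h. Qed.

(** * The Schur complement and its inverse over a commutative ring *)

Section Schur.
Variables (A : comNzRingType) (n m k : nat).
Implicit Types (M N : 'M[A]_(n + k, m + k)) (c : A).

(** [\det D] times the usual Schur complement; with the adjugate in place of the inverse it also
    applies to matrices of indeterminates and commutes with ring morphisms. *)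
Definition schur M : 'M[A]_(n, m) :=
  \det (drsubmx M) *: ulsubmx M - ursubmx M *m \adj (drsubmx M) *m dlsubmx M.

(* Inverse of [schur] when [c] is the inverse of [\det (drsubmx N)]; only the
   blocks of [N] other than the upper left one matter. *)
Definition unschur c N (X : 'M[A]_(n, m)) : 'M[A]_(n + k, m + k) :=
  block_mx (c *: (X + ursubmx N *m \adj (drsubmx N) *m dlsubmx N))
           (ursubmx N) (dlsubmx N) (drsubmx N).

Lemma schurK c N X : c * \det (drsubmx N) = 1 -> schur (unschur c N X) = X.
Proof.
move=> cd; rewrite /schur /unschur block_mxKul block_mxKur.
by rewrite block_mxKdl block_mxKdr scalerA mulrC cd scale1r addrK.
Qed.

Lemma unschurK c N : c * \det (drsubmx N) = 1 -> unschur c N (schur N) = N.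
Proof. by move=> cd; rewrite /unschur subrK scalerA cd scale1r submxK. Qed.

Lemma eq_unschur c N M : ursubmx N = ursubmx M -> dlsubmx N = dlsubmx M ->
  drsubmx N = drsubmx M -> unschur c N =1 unschur c M.
Proof. by move=> eqB eqC eqD X; rewrite /unschur eqB eqC eqD. Qed.

(** [unschur] is affine in [X], so the correction term cancels in differences; generators of a fiber
    ideal thus go to multiples of generators. *)
Lemma unschurB_ul c N X1 X2 i j :
  unschur c N X1 (lshift k i) (lshift k j)
  - unschur c N X2 (lshift k i) (lshift k j)
  = c * (X1 i j - X2 i j).
Proof. by rewrite !block_mxEul !mxE -mulrBr opprD addrACA subrr addr0. Qed.

Lemma unschurB_r c N X1 X2 i j :
  unschur c N X1 i (rshift m j) - unschur c N X2 i (rshift m j) = 0.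
Proof.
by case: (split_ordP i) => i' ->; rewrite ?block_mxEur ?block_mxEdr subrr.
Qed.

Lemma unschurB_d c N X1 X2 i j :
  unschur c N X1 (rshift n i) j - unschur c N X2 (rshift n i) j = 0.
Proof.
by case: (split_ordP j) => j' ->; rewrite ?block_mxEdl ?block_mxEdr subrr.
Qed.

Lemma schurB M N i j : ursubmx M = ursubmx N -> dlsubmx M = dlsubmx N ->
  drsubmx M = drsubmx N ->
  schur M i j - schur N i j =
  \det (drsubmx N) *
    (M (lshift k i) (lshift k j) - N (lshift k i) (lshift k j)).
Proof.
move=> eqB eqC eqD; rewrite /schur eqB eqC eqD !mxE.
by rewrite opprD addrACA subrr addr0 -mulrBr.
Qed.

End Schur.

Lemma map_schur (A B : comNzRingType) (f : {rmorphism A -> B}) n m k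
    (M : 'M[A]_(n + k, m + k)) : map_mx f (schur M) = schur (map_mx f M).
Proof.
rewrite /schur map_mxB map_mxZ !map_mxM map_mx_adj -det_map_mx.
by rewrite map_ulsubmx map_ursubmx map_dlsubmx map_drsubmx.
Qed.

Lemma map_unschur (A B : comNzRingType) (f : {rmorphism A -> B}) n m k c
    (N : 'M[A]_(n + k, m + k)) X :
  map_mx f (unschur c N X) = unschur (f c) (map_mx f N) (map_mx f X).
Proof.
rewrite /unschur map_block_mx map_mxZ map_mxD !map_mxM map_mx_adj.
by rewrite map_ursubmx map_dlsubmx map_drsubmx.
Qed.

(** Block elimination: unipotent [L] and [R] clear the off-diagonal blocks and leave the Schur
    complement, up to the unit [\det D], next to [D]. *)
Lemma rank_schur (F : fieldType) (n m k : nat) (M : 'M[F]_(n + k, m + k)) :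
  \det (drsubmx M) != 0 -> \rank M = (k + \rank (schur M))%N.
Proof.
set D := drsubmx M => dD0.
have uD : D \in unitmx by rewrite unitmxE unitfE.
pose L : 'M_(n + k) := block_mx 1%:M (- (ursubmx M *m invmx D)) 0 1%:M.
pose R : 'M_(m + k) := block_mx 1%:M 0 (- (invmx D *m dlsubmx M)) 1%:M.
have uL : L \in unitmx by rewrite unitmxE det_ublock !det1 mul1r unitr1.
have uR : R \in unitmx by rewrite unitmxE det_lblock !det1 mul1r unitr1.
have LMR : L *m M *m R = block_mx ((\det D)^-1 *: schur M) 0 0 D.
  rewrite -{1}[M]submxK -/D !mulmx_block !mul1mx !mul0mx !mulmx1 !mulmx0 !add0r.
  rewrite !mulNmx !mulmxN mulmxKV // addrN mul0mx oppr0 addr0.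
  rewrite mulmxA mulmxV // mul1mx addrN.
  rewrite /schur -/D scalerBr scalerA mulVf // scale1r /invmx uD.
  by rewrite -scalemxAr -scalemxAl.
rewrite -(mxrankMfree M (_ : row_free R)) ?row_free_unit //.
rewrite -(eqmxMfull (M *m R) (_ : row_full L)) ?row_full_unit // mulmxA LMR.
by rewrite rank_diag_block_mx mxrank_scale_nz ?invr_eq0 // mxrank_unit // addnC.
Qed.

Lemma projP (F : fieldType) (a b : nat) (S : {set 'I_a * 'I_b})
    (M N : 'M[F]_(a, b)) :
  proj S M = proj S N <-> forall i j, (i, j) \in S -> M i j = N i j.
Proof.
split=> [eqMN i j Sij | eqMN].
  have /rowP/(_ (enum_rank_in Sij (i, j))) := eqMN.
  by rewrite !mxE enum_rankK_in.
apply/rowP=> l; rewrite !mxE; apply: eqMN.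
by rewrite -surjective_pairing; exact: enum_valP.
Qed.

(** * The scheme-theoretic fibers *)

Section FiberIdeal.
Variables (F : fieldType) (a b : nat) (S : {set 'I_a * 'I_b}) (rho : nat).
Implicit Types (p q : MPoly F (a * b)) (A : 'rV[F]_#|S|) (N : 'M[F]_(a, b)).

Lemma fiber_idealD A p q :
  fiber_ideal rho A p -> fiber_ideal rho A q -> fiber_ideal rho A (p + q).
Proof.
move=> [p1 [h1 [p1I ->]]] [p2 [h2 [p2I ->]]].
exists (p1 + p2), (fun j => h1 j + h2 j); split.
  by move=> M rM; rewrite -/(evalp _ _) rmorphD /= /evalp p1I // p2I // addr0.
rewrite addrACA -big_split; congr (_ + _).
by apply: eq_bigr => j _; rewrite mulrDl.
Qed.

Lemma fiber_idealM A p q : fiber_ideal rho A q -> fiber_ideal rho A (p * q).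
Proof.
move=> [q1 [h [q1I ->]]]; exists (p * q1), (fun j => p * h j); split.
  by move=> M rM; rewrite -/(evalp _ _) rmorphM /= /evalp q1I // mulr0.
rewrite mulrDr mulr_sumr; congr (_ + _).
by apply: eq_bigr => j _; rewrite mulrA.
Qed.

Lemma sub_rank_fiber_ideal A p : rank_ideal rho p -> fiber_ideal rho A p.
Proof.
move=> Ip; exists p, (fun=> 0); split=> //.
by rewrite big1 ?addr0 // => j _; rewrite mul0r.
Qed.

Lemma fiber_ideal0 A : fiber_ideal rho A 0.
Proof. by apply: sub_rank_fiber_ideal => M _; rewrite /peval meval0. Qed.

Lemma fiber_idealB A p q :
  fiber_ideal rho A p -> fiber_ideal rho A q -> fiber_ideal rho A (p - q).
Proof.
move=> Ip Iq; rewrite -mulN1r; apply: fiber_idealD => //.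
exact: fiber_idealM.
Qed.

Lemma fiber_ideal_gen N i j : (i, j) \in S ->
  fiber_ideal rho (proj S N) (varmx F a b i j - mpolyC (a * b) (N i j)).
Proof.
move=> Sij; pose l := enum_rank_in Sij (i, j).
exists 0, (fun l' => (l' == l)%:R); split.
  by move=> M _; rewrite /peval meval0.
rewrite add0r (bigD1 l) //= eqxx mul1r big1 => [|l' /negPf ->].
  by rewrite addr0 !mxE enum_rankK_in.
by rewrite mul0r.
Qed.

(** The fiber ideal is generated by the rank ideal and the equations of the specified entries. [J]
    will be the preimage of another fiber ideal under a ring morphism. *)
Lemma fiber_ideal_min N (J : MPoly F (a * b) -> Prop) :
  (forall p q, J p -> J q -> J (p + q)) -> (forall p q, J q -> J (p * q)) ->
  (forall p, rank_ideal rho p -> J p) ->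
  (forall i j, (i, j) \in S ->
     J (varmx F a b i j - mpolyC (a * b) (N i j))) ->
  forall p, fiber_ideal rho (proj S N) p -> J p.
Proof.
move=> JD JM Jrank Jgen _ [q [h [Iq ->]]]; apply: (JD); first exact: Jrank.
have J0 : J 0 by apply: Jrank => M _; rewrite /peval meval0.
apply: (big_ind J) => // j _; apply: JM; rewrite mxE.
have := Jgen (enum_val j).1 (enum_val j).2; rewrite mxE; apply.
by rewrite -surjective_pairing; exact: enum_valP.
Qed.

(* A ring endomorphism that fixes the constants and moves the variables only
   within the fiber ideal is the identity modulo that ideal. *)
Lemma fiber_ideal_congr A (f : {rmorphism MPoly F (a * b) -> MPoly F (a * b)}) :
  (forall c, f (mpolyC (a * b) c) = mpolyC (a * b) c) ->
  (forall i j, fiber_ideal rho A (varmx F a b i j - f (varmx F a b i j))) ->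
  forall p, fiber_ideal rho A (p - f p).
Proof.
move=> fC fX; elim/mpoly_ring_ind => [c|l|p q Ip Iq|p q Ip Iq].
- by rewrite fC subrr; exact: fiber_ideal0.
- by case/mxvec_indexP: l => i j; have := fX i j; rewrite mxE.
- by rewrite rmorphD opprD addrACA; apply: fiber_idealD.
have -> : p * q - f (p * q) = q * (p - f p) + f p * (q - f q).
  by rewrite rmorphM !mulrBr [q * p]mulrC [q * f p]mulrC addrA subrK.
by apply: fiber_idealD; apply: fiber_idealM.
Qed.

End FiberIdeal.

Lemma mx_ul_ur_dl_drP (n m k : nat) (P : 'I_(n + k) -> 'I_(m + k) -> Prop) :
  (forall i j, P (lshift k i) (lshift k j)) ->
  (forall i j, P (lshift k i) (rshift m j)) ->
  (forall i j, P (rshift n i) (lshift k j)) ->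
  (forall i j, P (rshift n i) (rshift m j)) -> forall i j, P i j.
Proof.
move=> Pul Pur Pdl Pdr i j.
by case: (split_ordP i) => i' ->; case: (split_ordP j) => j' ->.
Qed.

(** * Completions and the Schur complement *)

Section Completion.
Variables (F : fieldType) (n m k : nat) (U : {set 'I_n * 'I_m}).
Let S : {set 'I_n * 'I_m} := ~: U.
Let S' : {set 'I_(n + k) * 'I_(m + k)} := ~: (@widen_pair n m k @: U).
Implicit Types (M N : 'M[F]_(n + k, m + k)) (X : 'M[F]_(n, m)).

Lemma mem_widen_ul i j : ((lshift k i, lshift k j) \in S') = ((i, j) \in S).
Proof.
rewrite !inE; congr (~~ _).
rewrite -[(_, _)]/(widen_pair k (i, j)) mem_imset //.
by move=> [i1 j1] [i2 j2] [/val_inj -> /val_inj ->].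
Qed.

Lemma mem_widen_r i j : (i, rshift m j) \in S'.
Proof.
rewrite inE; apply/imsetP => -[u _ /(congr1 snd)/eqP].
by rewrite /= eq_rlshift.
Qed.

Lemma mem_widen_d i j : (rshift n i, j) \in S'.
Proof.
rewrite inE; apply/imsetP => -[u _ /(congr1 fst)/eqP].
by rewrite /= eq_rlshift.
Qed.

Lemma proj_widenP M N : proj S' M = proj S' N <->
  [/\ proj S (ulsubmx M) = proj S (ulsubmx N), ursubmx M = ursubmx N,
      dlsubmx M = dlsubmx N & drsubmx M = drsubmx N].
Proof.
split=> [/projP eqMN | [/projP eq_ul eq_ur eq_dl eq_dr]].
  split; first by apply/projP=> i j Sij; rewrite !mxE eqMN ?mem_widen_ul.
  - by apply/matrixP=> i j; rewrite !mxE eqMN ?mem_widen_r.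
  - by apply/matrixP=> i j; rewrite !mxE eqMN ?mem_widen_d.
  by apply/matrixP=> i j; rewrite !mxE eqMN ?mem_widen_d.
apply/projP; apply: mx_ul_ur_dl_drP => i j.
- by rewrite mem_widen_ul => /eq_ul; rewrite !mxE.
- by move=> _; have /matrixP/(_ i j) := eq_ur; rewrite !mxE.
- by move=> _; have /matrixP/(_ i j) := eq_dl; rewrite !mxE.
- by move=> _; have /matrixP/(_ i j) := eq_dr; rewrite !mxE.
Qed.

(** The term [B adj(D) C] involves only fully specified blocks, and [A] is rescaled entrywise, so
    the entries of the complement in [S] depend on specified entries only. *)
Lemma proj_schur M N :
  proj S' M = proj S' N -> proj S (schur M) = proj S (schur N).
Proof.
case/proj_widenP => /projP eq_ul eq_ur eq_dl eq_dr; apply/projP=> i j Sij.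
rewrite /schur eq_ur eq_dl eq_dr !mxE.
by have := eq_ul i j Sij; rewrite !mxE => ->.
Qed.

Variable N : 'M[F]_(n + k, m + k).
Hypothesis dN : \det (drsubmx N) != 0.
Let c := (\det (drsubmx N))^-1.
Let cd : c * \det (drsubmx N) = 1. Proof. exact: mulVf. Qed.

Lemma proj_unschur X :
  proj S (schur N) = proj S X -> proj S' (unschur c N X) = proj S' N.
Proof.
move=> /projP eqX; rewrite -[in RHS](unschurK cd); apply/proj_widenP.
rewrite /unschur !block_mxKul !block_mxKur !block_mxKdl !block_mxKdr.
split=> //; apply/projP=> i j Sij; rewrite mxE [RHS]mxE; congr (_ * _).
by rewrite mxE [RHS]mxE eqX.
Qed.

(** All completions share the outer blocks (all but the upper left), which [unschur] reads from [N].
    With [schurK] and [proj_unschur] this makes [schur] a bijection between the completions. *)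
Lemma unschur_completionK M :
  proj S' M = proj S' N -> unschur c N (schur M) = M.
Proof.
case/proj_widenP => _ eq_ur eq_dl eq_dr.
rewrite (eq_unschur _ (esym eq_ur) (esym eq_dl) (esym eq_dr)).
by apply: unschurK; rewrite eq_dr.
Qed.

Lemma rank_unschur X : \rank (unschur c N X) = (k + \rank X)%N.
Proof. by rewrite rank_schur ?schurK // /unschur block_mxKdr. Qed.

Lemma rank_completion M :
  proj S' M = proj S' N -> \rank M = (k + \rank (schur M))%N.
Proof. by case/proj_widenP => _ _ _ eq_dr; rewrite rank_schur ?eq_dr. Qed.

Lemma completion_schur rho M : is_completion (k + rho) (proj S' N) M ->
  is_completion rho (proj S (schur N)) (schur M).
Proof.
case=> rM eM; split; last exact: proj_schur.
by move: rM; rewrite (rank_completion eM) leq_add2l.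
Qed.

Lemma completion_unschur rho X : is_completion rho (proj S (schur N)) X ->
  is_completion (k + rho) (proj S' N) (unschur c N X).
Proof.
by case=> rX eX; split; rewrite ?rank_unschur ?leq_add2l // proj_unschur.
Qed.

Lemma ex_completion_schur rho :
  (exists X, is_completion rho (proj S (schur N)) X) <->
  (exists M, is_completion (k + rho) (proj S' N) M).
Proof.
split=> [[X /completion_unschur] | [M /completion_schur]].
  by exists (unschur c N X).
by exists (schur M).
Qed.

Lemma unique_completion_schur rho :
  (exists! X, is_completion rho (proj S (schur N)) X) <->
  (exists! M, is_completion (k + rho) (proj S' N) M).
Proof.
split=> [[X [cX uX]] | [M [cM uM]]].
  exists (unschur c N X); split=> [|M cM]; first exact: completion_unschur.
  by rewrite (uX _ (completion_schur cM)) unschur_completionK //; case: cM.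
exists (schur M); split=> [|X cX]; first exact: completion_schur.
by rewrite (uM _ (completion_unschur cX)) schurK.
Qed.

Lemma min_completion_rank_schur rho :
  min_completion_rank_is (proj S (schur N)) rho <->
  min_completion_rank_is (proj S' N) (k + rho).
Proof.
split=> -[[M eM rM] minM].
  split.
    by exists (unschur c N M); rewrite ?rank_unschur ?rM ?proj_unschur.
  move=> M' eM'; rewrite (rank_completion eM') leq_add2l minM //.
  exact: proj_schur.
split.
  exists (schur M); first exact: proj_schur.
  by apply/eqP; rewrite -(eqn_add2l k) -(rank_completion eM) rM.
move=> X eX; have := minM _ (proj_unschur (esym eX)).
by rewrite rank_unschur leq_add2l.
Qed.

Lemma min_completion_rank_ge rho :
  min_completion_rank_is (proj S' N) rho -> (k <= rho)%N.
Proof. by case=> -[M eM <-] _; rewrite (rank_completion eM) leq_addr. Qed.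


(** * Ring morphisms between the two coordinate rings *)

Variable rho : nat.
Let I := @fiber_ideal F n m S rho (proj S (schur N)).
Let I' := @fiber_ideal F (n + k) (m + k) S' (k + rho) (proj S' N).
Let P := MPoly F (n * m).
Let P' := MPoly F ((n + k) * (m + k)).
Let X : 'M[P]_(n, m) := varmx F n m.
Let X' : 'M[P']_(n + k, m + k) := varmx F (n + k) (m + k).
Let NP : 'M[P]_(n + k, m + k) := map_mx (@mpolyC (n * m) F) N.
Let NP' : 'M[P']_(n + k, m + k) := map_mx (@mpolyC ((n + k) * (m + k)) F) N.
Let cP : P := mpolyC (n * m) c.
Let cP' : P' := mpolyC ((n + k) * (m + k)) c.

Let cdP : cP * \det (drsubmx NP) = 1.
Proof. by rewrite -map_drsubmx det_map_mx -rmorphM cd rmorph1. Qed.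

(* [X'] with the blocks whose entries are all specified set to their values. *)
Let Y : 'M[P']_(n + k, m + k) :=
  block_mx (ulsubmx X') (ursubmx NP') (dlsubmx NP') (drsubmx NP').

Let cdY : cP' * \det (drsubmx Y) = 1.
Proof. by rewrite block_mxKdr -map_drsubmx det_map_mx -rmorphM cd rmorph1. Qed.

(** [phi] is the comorphism of [unschur], and [psi] that of [schur] after the outer blocks have been
    set to their specified values. *)
Let Phi : 'M[P]_(n + k, m + k) := unschur cP NP X.
Let phi : {rmorphism P' -> P} := subst (mxvec Phi).
Let psi : {rmorphism P -> P'} := subst (mxvec (schur Y)).

Let phiC a : phi (mpolyC _ a) = mpolyC _ a. Proof. exact: substC. Qed.
Let psiC a : psi (mpolyC _ a) = mpolyC _ a. Proof. exact: substC. Qed.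
Let phiX : map_mx phi X' = Phi. Proof. exact: map_varmx_subst. Qed.
Let psiX : map_mx psi X = schur Y. Proof. exact: map_varmx_subst. Qed.

Let phiE i j : phi (X' i j) = Phi i j.
Proof. by rewrite mxE [LHS]substX mxvecE. Qed.
Let psiE i j : psi (X i j) = schur Y i j.
Proof. by rewrite mxE [LHS]substX mxvecE. Qed.

(** The round trip replaces the variables of the outer blocks by their values, hence [Y] and not
    [X']. *)
Let psi_phiX : map_mx (psi \o phi) X' = Y.
Proof.
rewrite map_mx_comp phiX map_unschur psiX psiC.
rewrite (map_mpolyC _ psiC) -/NP' -[RHS](unschurK cdY).
by apply: eq_unschur; rewrite ?block_mxKur ?block_mxKdl ?block_mxKdr.
Qed.

(** An exact identity: the outer blocks of [Phi] are already constant, so [phi] maps [Y] to [Phi],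
    and [schurK] applies. *)
Let phi_psi p : phi (psi p) = p.
Proof.
have phiY : map_mx phi Y = Phi.
  rewrite map_block_mx map_ulsubmx phiX map_ursubmx map_dlsubmx map_drsubmx.
  by rewrite (map_mpolyC _ phiC) -/NP block_mxKul.
rewrite (rmorph_subst _ _ phiC) map_mxvec map_schur phiY schurK //.
exact: subst_varmx.
Qed.

(** [X'] and [Y] differ only in the outer blocks, by generators of [I']. *)
Let psi_phi_mod p : I' (p - psi (phi p)).
Proof.
apply: (fiber_ideal_congr (f := psi \o phi)) => [a|].
  by rewrite /= phiC psiC.
have E i j : psi (phi (X' i j)) = Y i j by rewrite -psi_phiX [RHS]mxE.
apply: mx_ul_ur_dl_drP => i j; rewrite /= -/(X' _ _) E.
- by rewrite block_mxEul !mxE subrr; exact: fiber_ideal0.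
- rewrite block_mxEur !mxE.
  have := fiber_ideal_gen (k + rho) N (mem_widen_r (lshift k i) j).
  by rewrite mxE.
- rewrite block_mxEdl !mxE.
  have := fiber_ideal_gen (k + rho) N (mem_widen_d i (lshift k j)).
  by rewrite mxE.
rewrite block_mxEdr !mxE.
have := fiber_ideal_gen (k + rho) N (mem_widen_d i (rshift m j)).
by rewrite mxE.
Qed.

Let psi_phi_ideal p : I' p -> I' (psi (phi p)).
Proof.
move=> Ip; rewrite -[psi _](subKr p); apply: fiber_idealB => //.
exact: psi_phi_mod.
Qed.

(** For [p] in the rank ideal, evaluating [phi p] at [M] of rank at most [rho] is evaluating [p] at
    [unschur c N M], of rank at most [k + rho]. *)
Let phi_ideal p : I' p -> I (phi p).
Proof.
apply: (fiber_ideal_min (J := fun p => I (phi p))) => [p1 p2|p1 p2|p1 rp1|].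
- by rewrite rmorphD; exact: fiber_idealD.
- by rewrite rmorphM; exact: fiber_idealM.
- apply: sub_rank_fiber_ideal => M rM; rewrite -/(evalp _ _) evalp_subst.
  rewrite map_mxvec map_unschur map_varmx_evalp /= /cP /NP evalpC.
  rewrite (map_mpolyC _ (evalpC _)) map_mx_id //.
  by apply: rp1; rewrite rank_unschur leq_add2l.
move=> i j; rewrite rmorphB phiC phiE.
(* Writing [N] as [unschur] of its own complement turns the image of a generator into a difference
   of two values of [unschur]. *)
have -> : mpolyC (n * m) (N i j) =
    unschur cP NP (map_mx (@mpolyC _ F) (schur N)) i j.
  by rewrite -map_unschur unschurK // mxE.
move: i j; apply: mx_ul_ur_dl_drP => i j.
- rewrite mem_widen_ul unschurB_ul => Sij; apply: fiber_idealM.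
  by rewrite [X in _ - X]mxE; apply: fiber_ideal_gen.
- by move=> _; rewrite unschurB_r; exact: fiber_ideal0.
- by move=> _; rewrite unschurB_d; exact: fiber_ideal0.
- by move=> _; rewrite unschurB_d; exact: fiber_ideal0.
Qed.

Let psi_ideal p : I p -> I' (psi p).
Proof.
apply: (fiber_ideal_min (J := fun p => I' (psi p))) =>
  [p1 p2|p1 p2|q rq|i j Sij].
- by rewrite rmorphD; exact: fiber_idealD.
- by rewrite rmorphM; exact: fiber_idealM.
- (* The determinant factor kills the points with a singular lower right
     block, where [rank_schur] does not apply; it is a unit modulo [I']. *)
  pose w := \det (drsubmx X') * subst (mxvec (schur X')) q.
  have Iw : I' w.
    apply: sub_rank_fiber_ideal => M rM; rewrite -/(evalp _ _) rmorphM /=.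
    rewrite -det_map_mx map_drsubmx evalp_subst map_mxvec map_schur.
    rewrite map_varmx_evalp; have [->|dM] := eqVneq (\det (drsubmx M)) 0.
      by rewrite mul0r.
    rewrite [evalp _ q]rq ?mulr0 //.
    by move: rM; rewrite rank_schur // leq_add2l.
  (* [psi \o phi] freezes the outer blocks: the determinant in [w] becomes a constant with inverse
     [cP'], and the other factor becomes [psi q]. *)
  have -> : psi q = cP' * psi (phi w).
    have -> : psi (phi w) = \det (drsubmx Y) * psi q.
      rewrite /w -[LHS]/((psi \o phi) _) rmorphM; congr (_ * _).
        by rewrite -det_map_mx map_drsubmx psi_phiX.
      have psi_phiC a : (psi \o phi) (mpolyC _ a) = mpolyC _ a.
        by rewrite /= phiC psiC.
      by rewrite (rmorph_subst _ _ psi_phiC) map_mxvec map_schur psi_phiX.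
    by rewrite mulrA cdY mul1r.
  by apply: fiber_idealM; apply: psi_phi_ideal.
rewrite rmorphB psiC psiE.
have -> : mpolyC ((n + k) * (m + k)) (schur N i j) = schur NP' i j.
  by rewrite -map_schur [RHS]mxE.
rewrite schurB ?block_mxKur ?block_mxKdl ?block_mxKdr //; apply: fiber_idealM.
rewrite block_mxEul [X in _ - X]mxE [ulsubmx _ _ _]mxE [usubmx _ _ _]mxE.
by apply: fiber_ideal_gen; rewrite mem_widen_ul.
Qed.

(** [phi] and [psi] induce mutually inverse isomorphisms between the quotients by [I'] and [I], so
    nilpotents correspond. *)
Lemma radical_fiber_schur : radical_ideal I <-> radical_ideal I'.
Proof.
split=> rad p e Ipe.
  have /phi_ideal := Ipe; rewrite rmorphXn => /rad/psi_ideal Ip.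
  rewrite -[p](subrK (psi (phi p))); apply: fiber_idealD => //.
  exact: psi_phi_mod.
rewrite -[p]phi_psi; apply: phi_ideal; apply: (rad _ e).
by rewrite -rmorphXn; apply: psi_ideal.
Qed.

End Completion.

(** * Transfer of genericity and of open sets *)

(** A section of [proj], zero at the unspecified positions; the general coefficients allow rows of
    indeterminates. *)
Definition fill (A : nmodType) (a b : nat) (S : {set 'I_a * 'I_b})
    (x : 'rV[A]_#|S|) : 'M[A]_(a, b) :=
  \matrix_(i, j)
    if [pick l : 'I_#|S| | enum_val l == (i, j)] is Some l then x 0 l else 0.

Lemma proj_fill (F : fieldType) (a b : nat) (S : {set 'I_a * 'I_b})
    (x : 'rV[F]_#|S|) : proj S (fill x) = x.
Proof.
apply/rowP => j; rewrite !mxE; case: pickP => [l /eqP | /(_ j)].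
  by rewrite -surjective_pairing => /enum_val_inj ->.
by rewrite -surjective_pairing eqxx.
Qed.

Lemma map_fill (A B : nmodType) (f : {additive A -> B}) (a b : nat)
    (S : {set 'I_a * 'I_b}) (x : 'rV[A]_#|S|) :
  map_mx f (fill x) = fill (map_mx f x).
Proof.
apply/matrixP=> i j; rewrite !mxE.
by case: pickP => [l _|_]; rewrite ?mxE ?raddf0.
Qed.

Definition varrow (F : fieldType) (N : nat) : 'rV[MPoly F N]_N :=
  \row_i mpolyX F (mnm1 i).

Lemma map_varrow_evalp (F : fieldType) (N : nat) (x : 'rV[F]_N) :
  map_mx (evalp x) (varrow F N) = x.
Proof. by apply/rowP=> i; rewrite !mxE evalpX. Qed.

Lemma evalp_line (F : fieldType) (N : nat) (p : MPoly F N) (x y : 'rV[F]_N) :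
  exists u : {poly F}, forall t, evalp (x + t *: (y - x)) p = u.[t].
Proof.
elim/mpoly_ring_ind: p => [c|i|p q [u up] [v vq]|p q [u up] [v vq]].
- by exists c%:P => t; rewrite evalpC hornerC.
- exists ((x 0 i)%:P + 'X * (y 0 i - x 0 i)%:P) => t.
  by rewrite evalpX !mxE !hornerE.
- by exists (u + v) => t; rewrite rmorphD /= up vq hornerD.
by exists (u * v) => t; rewrite rmorphM /= up vq hornerM.
Qed.

(** The [size u] points [e/2, e/3, ...] outnumber the roots of [u]; the denominators start at 2 to
    stay strictly below [e]. *)
Lemma poly_nonroot_near0 (F : numFieldType) (u : {poly F}) (e : F) :
  u != 0 -> 0 < e -> exists t, [/\ 0 < t, t < e & u.[t] != 0].
Proof.
move=> u0 e0; pose rs := [seq e / i.+2%:R | i <- iota 0 (size u)].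
have rs_inj : injective (fun i : nat => e / i.+2%:R).
  move=> i j /(mulfI (lt0r_neq0 e0)) /invr_inj /eqP.
  by rewrite eqr_nat => /eqP [].
have [/allP all_root|/allPn [t]] := boolP (all (root u) rs).
  have := max_poly_roots u0 (introT allP all_root).
  by rewrite size_map size_iota ltnn map_inj_uniq ?iota_uniq // => /(_ isT).
case/mapP=> i _ -> nr; exists (e / i.+2%:R); split=> //.
  by rewrite divr_gt0 ?ltr0Sn.
by rewrite ltr_pdivrMr ?ltr0Sn // ltr_pMr // ltr1n.
Qed.

(* Along the line through x and y the product p q restricts to a nonzero
   univariate polynomial. *)
Lemma evalp_neq0_near (F : numFieldType) (N : nat) (p q : MPoly F N)
    (x y : 'rV[F]_N) (e : F) : evalp x p != 0 -> evalp y q != 0 -> 0 < e ->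
  exists t, [/\ 0 < t, t < e, evalp (x + t *: (y - x)) p != 0
                            & evalp (x + t *: (y - x)) q != 0].
Proof.
move=> px qy e0; have [u up] := evalp_line p x y.
have [v vq] := evalp_line q x y.
have uv0 : u * v != 0.
  apply: mulf_neq0; apply/eqP.
    move=> u0; move: px; rewrite -[x]addr0 -(scale0r (y - x)).
    by rewrite up u0 horner0 eqxx.
  move=> v0; move: qy.
  have -> : y = x + 1 *: (y - x) by rewrite scale1r addrC subrK.
  by rewrite vq v0 horner0 eqxx.
have [t [t0 te]] := poly_nonroot_near0 uv0 e0.
by rewrite hornerM mulf_eq0 negb_or -up -vq => /andP[? ?]; exists t.
Qed.

(** One defining equation of [Z] that fails at some point outside it is enough: [Z] lies in its zero
    locus. *)
Lemma generically_polyP (F : fieldType) (N : nat) (P : set 'rV[F]_N) :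
  generically P <->
  exists p x, evalp x p != 0 /\ forall y, evalp y p != 0 -> P y.
Proof.
split=> [[Z [[I ->] /eqP IT ZP]] | [p [x [px pP]]]].
  have [x /existsNP [p /not_implyP [Ip /eqP px]]] :
      exists x, ~ forall p, I p -> peval p x = 0.
    apply: contrapT => /forallNP H; apply: IT; apply/seteqP; split=> // x _ /=.
    by apply: contrapT; exact: H.
  by exists p, x; split=> // y py; apply: ZP => /(_ p Ip) /eqP; apply/negP.
exists [set y | evalp y p = 0]; split=> [||y /eqP]; last exact: pP.
  by exists [set p]; apply/seteqP; split=> y /= => [yp _ ->|]; last exact.
by apply/eqP => /seteqP [_ /(_ x I)] /eqP; apply/negP.
Qed.

Section Transfer.
Variables (n m k : nat) (U : {set 'I_n * 'I_m}).
Let S : {set 'I_n * 'I_m} := ~: U.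
Let S' : {set 'I_(n + k) * 'I_(m + k)} := ~: (@widen_pair n m k @: U).

(** * The Schur complement as a polynomial map of partial matrices *)

Section Rational.
Variable F : fieldType.
Implicit Types (N : 'M[F]_(n + k, m + k)).

Definition corner_det : MPoly F #|S'| := \det (drsubmx (fill (varrow F #|S'|))).

(** The zeros that [fill] puts at unspecified positions do not matter, by [proj_schur]. *)
Definition schur_map : 'rV[MPoly F #|S'|]_#|S| :=
  \row_l schur (fill (varrow F #|S'|)) (enum_val l).1 (enum_val l).2.

(** When [N] has an invertible corner, this is a polynomial section of [schur_map] that passes
    through [proj S' N]. *)
Definition unschur_map N : 'rV[MPoly F #|S|]_#|S'| :=
  \row_l unschur (mpolyC #|S| (\det (drsubmx N))^-1)
    (map_mx (@mpolyC #|S| F) N) (fill (varrow F #|S|))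
    (enum_val l).1 (enum_val l).2.

Lemma evalp_corner_det (x' : 'rV[F]_#|S'|) :
  evalp x' corner_det = \det (drsubmx (fill x')).
Proof. by rewrite -det_map_mx map_drsubmx map_fill map_varrow_evalp. Qed.

Lemma evalp_schur_map (x' : 'rV[F]_#|S'|) :
  map_mx (evalp x') schur_map = proj S (schur (fill x')).
Proof.
rewrite -[in RHS](map_varrow_evalp x') -map_fill -map_schur.
by apply/rowP=> l; rewrite [LHS]mxE [in LHS]mxE [RHS]mxE [RHS]mxE.
Qed.

Lemma evalp_unschur_map N (x : 'rV[F]_#|S|) : map_mx (evalp x) (unschur_map N) =
  proj S' (unschur (\det (drsubmx N))^-1 N (fill x)).
Proof.
have -> : unschur (\det (drsubmx N))^-1 N (fill x) = map_mx (evalp x)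
    (unschur (mpolyC #|S| (\det (drsubmx N))^-1) (map_mx (@mpolyC #|S| F) N)
       (fill (varrow F #|S|))).
  rewrite map_unschur map_fill map_varrow_evalp /= evalpC.
  by rewrite (map_mpolyC _ (evalpC _)) map_mx_id.
by apply/rowP=> l; rewrite [LHS]mxE [in LHS]mxE [RHS]mxE [RHS]mxE.
Qed.

Lemma corner_det_proj N : evalp (proj S' N) corner_det = \det (drsubmx N).
Proof.
rewrite evalp_corner_det.
have /proj_widenP [_ _ _ ->] // : proj S' (fill (proj S' N)) = proj S' N.
exact: proj_fill.
Qed.

Lemma schur_map_proj N :
  map_mx (evalp (proj S' N)) schur_map = proj S (schur N).
Proof. by rewrite evalp_schur_map; apply: proj_schur; exact: proj_fill. Qed.

Lemma unschur_map_schur N : \det (drsubmx N) != 0 ->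
  map_mx (evalp (proj S (schur N))) (unschur_map N) = proj S' N.
Proof. by move=> dN; rewrite evalp_unschur_map proj_unschur // proj_fill. Qed.

Lemma corner_det_neq0 : exists x', evalp x' corner_det != 0.
Proof.
exists (proj S' (block_mx 0 0 0 1%:M)).
by rewrite corner_det_proj block_mxKdr det1 oner_neq0.
Qed.

Lemma schur_map_surj (x : 'rV[F]_#|S|) :
  exists2 x', evalp x' corner_det != 0 & map_mx (evalp x') schur_map = x.
Proof.
pose N := unschur 1 (block_mx 0 0 0 1%:M : 'M_(n + k, m + k)) (fill x).
exists (proj S' N).
  by rewrite corner_det_proj /N !block_mxKdr det1 oner_neq0.
by rewrite schur_map_proj /N schurK ?proj_fill // block_mxKdr det1 mulr1.
Qed.

Variables (P : set 'rV[F]_#|S|) (P' : set 'rV[F]_#|S'|).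
Hypothesis PP' : forall N, \det (drsubmx N) != 0 ->
  P (proj S (schur N)) <-> P' (proj S' N).

Lemma transfer_schur (x' : 'rV[F]_#|S'|) :
  evalp x' corner_det != 0 ->
  P (map_mx (evalp x') schur_map) <-> P' x'.
Proof.
by rewrite -[x'](proj_fill) corner_det_proj schur_map_proj; exact: PP'.
Qed.

Lemma transfer_unschur N (x : 'rV[F]_#|S|) : \det (drsubmx N) != 0 ->
  P x <-> P' (map_mx (evalp x) (unschur_map N)).
Proof.
move=> dN; have cd := mulVf dN.
rewrite evalp_unschur_map -PP' ?schurK ?proj_fill //.
by rewrite block_mxKdr.
Qed.

End Rational.

(** * Transfer of generic properties *)

Lemma generic_corner (F : numFieldType) (P' : set 'rV[F]_#|S'|) :
  generically P' ->
  exists2 N, \det (drsubmx N) != 0 & P' (proj S' N).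
Proof.
case/generically_polyP => p [x [px pP]]; have [y dy] := corner_det_neq0 F.
have [t [_ _ pz dz]] := evalp_neq0_near px dy ltr01.
exists (fill (x + t *: (y - x))); first by rewrite -evalp_corner_det.
by rewrite proj_fill; exact: pP.
Qed.

(** Forward, [p] is pulled back along [schur_map] and multiplied by [corner_det], which forces an
    invertible corner. Backward, [p] is pulled back along the section [unschur_map N]. *)
Lemma generically_transfer (F : numFieldType) (P : set 'rV[F]_#|S|)
    (P' : set 'rV[F]_#|S'|) :
  (forall N, \det (drsubmx N) != 0 ->
     P (proj S (schur N)) <-> P' (proj S' N)) ->
  generically P <-> generically P'.
Proof.
move=> PP'; split=> [/generically_polyP [p [x [px pP]]] | gP'].
  apply/generically_polyP; exists (corner_det F * subst (schur_map F) p).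
  have [x' dx' x'x] := schur_map_surj x; exists x'; split.
    by rewrite rmorphM /= evalp_subst x'x mulf_neq0.
  move=> y; rewrite rmorphM /= evalp_subst mulf_eq0 negb_or => /andP[dy py].
  by apply/(transfer_schur PP') => //; apply: pP.
have /generically_polyP [p [x' [px pP']]] := gP'.
(* [N] is chosen with [p] nonzero at [proj S' N], so that the pullback of [p] is not the zero
   polynomial. *)
have : generically [set y | evalp y p != 0].
  by apply/generically_polyP; exists p, x'.
case/generic_corner => N dN /= pN; apply/generically_polyP.
exists (subst (unschur_map N) p), (proj S (schur N)); split.
  by rewrite evalp_subst unschur_map_schur.
move=> y; rewrite evalp_subst => /pP' P'y.
exact/(transfer_unschur PP' _ dN).
Qed.

(** * Transfer of Euclidean open sets *)

Section Real.
Variable R : realType.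

Lemma continuous_rV (T : topologicalType) (N : nat) (f : T -> 'rV[R]_N) :
  (forall l, continuous (fun x => f x 0 l)) -> continuous f.
Proof.
move=> fc x A [P fxP PA].
have : \forall y \near x, forall l, P 0 l (f y 0 l).
  by apply: filter_forall => l; apply: (fc l x); exact: fxP.
apply: filterS => y Py; apply: PA => i l; rewrite (ord1 i); exact: Py.
Qed.

Lemma continuous_evalp (N : nat) (p : MPoly R N) :
  continuous (fun x : 'rV[R]_N => evalp x p).
Proof.
elim/mpoly_ring_ind: p => [c|i|p q pc qc|p q pc qc].
- have -> : (fun x : 'rV_N => evalp x (mpolyC N c)) = (fun=> c).
    by apply/funext=> x; rewrite evalpC.
  exact: cst_continuous.
- have -> : (fun x : 'rV_N => evalp x (mpolyX R (mnm1 i))) = (fun x => x 0 i).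
    by apply/funext=> x; rewrite evalpX.
  exact: coord_continuous.
- have -> : (fun x : 'rV_N => evalp x (p + q)) =
      (fun x => evalp x p + evalp x q).
    by apply/funext=> x; rewrite rmorphD.
  by move=> x; apply: continuousD; [exact: pc | exact: qc].
have -> : (fun x : 'rV_N => evalp x (p * q)) = (fun x => evalp x p * evalp x q).
  by apply/funext=> x; rewrite rmorphM.
by move=> x; apply: continuousM; [exact: pc | exact: qc].
Qed.

Lemma continuous_map_evalp (N1 N2 : nat) (Q : 'rV[MPoly R N2]_N1) :
  continuous (fun x : 'rV[R]_N2 => map_mx (evalp x) Q).
Proof.
apply: continuous_rV => l.
have -> : (fun x : 'rV_N2 => map_mx (evalp x) Q 0 l) =
    (fun x => evalp x (Q 0 l)).
  by apply/funext=> x; rewrite mxE.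
exact: continuous_evalp.
Qed.

(** From a point of [O], a suitable short move towards a point with invertible corner stays in [O]
    and avoids the zeros of [corner_det]. *)
Lemma open_corner (O : set 'rV[R]_#|S'|) : open O -> O !=set0 ->
  exists2 N, \det (drsubmx N) != 0 & O (proj S' N).
Proof.
move=> oO [x Ox]; have [y dy] := corner_det_neq0 R.
pose f (t : R) : 'rV[R]_#|S'| := x + t *: (y - x).
have fc : continuous f.
  apply: continuous_rV => l.
  have -> : (fun t => f t 0 l) = (fun t => x 0 l + t * (y 0 l - x 0 l)).
    by apply/funext=> t; rewrite !mxE.
  move=> t; apply: (@continuousD _ _ _ (fun=> x 0 l)
    (fun t : R => t * (y 0 l - x 0 l))).
    exact: cst_continuous.
  apply: (@continuousM _ _ id (fun=> y 0 l - x 0 l)); first exact: cvg_id.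
  exact: cst_continuous.
have : nbhs (0 : R) (f @^-1` O).
  by apply: fc; rewrite /f scale0r addr0; exact: open_nbhs_nbhs.
case/nbhs_ballP=> e /= e0 eO.
(* Only [corner_det] has to stay nonzero; the constant 1 serves as the other polynomial. *)
have one0 : evalp x 1 != 0 by rewrite rmorph1 oner_neq0.
have [t [t0 te _ dt]] := evalp_neq0_near one0 dy e0.
exists (fill (f t)); first by rewrite -evalp_corner_det.
by rewrite proj_fill; apply: eO; rewrite /ball /= sub0r normrN gtr0_norm.
Qed.

(** Preimages under the continuous maps [schur_map] and [unschur_map N], the former cut down to
    nonzero [corner_det]; taking [N] from [open_corner] keeps the latter nonempty. *)
Lemma open_transfer (P : set 'rV[R]_#|S|) (P' : set 'rV[R]_#|S'|) :
  (forall N, \det (drsubmx N) != 0 ->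
     P (proj S (schur N)) <-> P' (proj S' N)) ->
  (exists O, [/\ open O, O !=set0 & forall x, O x -> P x]) <->
  (exists O, [/\ open O, O !=set0 & forall x, O x -> P' x]).
Proof.
move=> PP'; split=> [[O [oO [x Ox] OP]] | [O [oO O0 OP']]].
  exists ((fun x' => evalp x' (corner_det R)) @^-1` [set t | t != 0] `&`
          (fun x' => map_mx (evalp x') (schur_map R)) @^-1` O).
  have [x' dx' x'x] := schur_map_surj x; split.
  - apply: openI.
      apply: open_comp; last exact: open_neq.
      by move=> y _; exact: continuous_evalp.
    by apply: open_comp => // y _; exact: continuous_map_evalp.
  - by exists x'; split=> //=; rewrite x'x.
  by move=> y [dy Oy]; apply/(transfer_schur PP') => //; exact: OP.
have [N dN ON] := open_corner oO O0.
exists ((fun x => map_mx (evalp x) (unschur_map N)) @^-1` O); split.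
- by apply: open_comp => // y _; exact: continuous_map_evalp.
- by exists (proj S (schur N)) => /=; rewrite unschur_map_schur.
by move=> y Oy; apply/(transfer_unschur PP' _ dN); exact: OP'.
Qed.

Lemma typical_ranks_widen (rho : nat) :
  typical_ranks R S rho <-> typical_ranks R S' (k + rho)%N.
Proof. by apply: open_transfer => N dN; exact: min_completion_rank_schur. Qed.

(** A nonempty open set contains a partial matrix with invertible [k] by [k] corner. Hence every
    typical rank of [S'] has the form [k + rho]. *)
Lemma typical_ranks_ge (rho : nat) : typical_ranks R S' rho -> (k <= rho)%N.
Proof.
case=> O [oO O0 OP]; have [N dN ON] := open_corner oO O0.
exact: (min_completion_rank_ge (N := N) dN (OP _ ON)).
Qed.

End Real.

(** * Generic completion rank and unique completability *)

Lemma generically_completable_widen (F : numFieldType) (rho : nat) :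
  generically_completable F S rho <-> generically_completable F S' (k + rho).
Proof. by apply: generically_transfer => N dN; exact: ex_completion_schur. Qed.

Lemma generically_completable_ge (F : numFieldType) (rho : nat) :
  generically_completable F S' rho -> (k <= rho)%N.
Proof.
case/generic_corner => N dN [M [rM eM]]; apply: leq_trans rM.
by rewrite (rank_completion dN eM) leq_addr.
Qed.

Lemma generic_completion_rank_widen (F : numFieldType) :
  generic_completion_rank F S' = (k + generic_completion_rank F S)%N.
Proof.
rewrite /generic_completion_rank.
case: ex_minnP => r' /asboolP cr' minr'; case: ex_minnP => r /asboolP cr minr.
apply/eqP; rewrite eqn_leq minr' /=; last first.
  exact/asboolP/generically_completable_widen.
(* Conversely, [r'] is at least [k], so [r' - k] is a rank to which [S] is generically
   completable. *)
have kr' := generically_completable_ge cr'.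
rewrite -(subnKC kr') leq_add2l; apply: minr; apply/asboolP.
by apply/generically_completable_widen; rewrite subnKC.
Qed.

Lemma generically_uniquely_completable_widen (F : numFieldType) (rho : nat) :
  generically_uniquely_completable F S rho <->
  generically_uniquely_completable F S' (k + rho).
Proof.
apply: generically_transfer => N dN.
have uE := unique_completion_schur U dN rho.
have rE := radical_fiber_schur U dN rho.
by split=> -[uM rad]; split; [apply/uE | apply/rE | apply/uE | apply/rE].
Qed.

End Transfer.

Theorem lemma3p1 (R : realType) (n m k : nat) (U : {set 'I_n * 'I_m}) :
  (1 <= n)%N -> (1 <= m)%N ->
  let S : {set 'I_n * 'I_m} := (~: U)%SET in
  let S' : {set 'I_(n + k) * 'I_(m + k)} := (~: (@widen_pair n m k @: U))%SET in
  [/\ generic_completion_corank R[i] S = generic_completion_corank R[i] S',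
      typical_coranks R S = typical_coranks R S'
    & forall r : nat, (r <= minn n m)%N ->
        uniquely_completable_to_corank R[i] S r <->
        uniquely_completable_to_corank R[i] S' r].
Proof.
move=> _ _ S S'; split=> [||r rnm].
- rewrite /generic_completion_corank generic_completion_rank_widen.
  by rewrite -addn_minl [(_ + k)%N]addnC subnDl.
- apply/seteqP; split=> [_ [rho Trho <-] | _ [rho Trho <-]].
    exists (k + rho)%N; first exact/(typical_ranks_widen k U).
    by rewrite -addn_minl [(_ + k)%N]addnC subnDl.
  have krho := typical_ranks_ge Trho; exists (rho - k)%N.
    by apply/(typical_ranks_widen k U); rewrite subnKC.
  by rewrite -addn_minl -[rho in RHS](subnKC krho) [(_ + k)%N]addnC subnDl.
rewrite /uniquely_completable_to_corank -addn_minl [(minn n m + k)%N]addnC.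
(* As [r] is at most [minn n m], truncated subtraction still gives
   [k + minn n m - r = k + (minn n m - r)]. *)
by rewrite -addnBA //; exact: generically_uniquely_completable_widen.
Qed.
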